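(* Let $p = (p_1, p_2, \ldots)$ be a probability distribution on the positive integers. Consider the algorithm $\textsf{optimal\_discrete}(p)$, which uses independent fair coin flips: (1) set $m \leftarrow 1$, $X \leftarrow 1$, $Y \leftarrow 0$; (2) while $Y = 0$: (3) let $A \leftarrow \{i : 2p_i \ge 1\}$ and $n \leftarrow \#A$; (4) for all $i$, set $p_i \leftarrow 2p_i - \mathbb{I}(2p_i \ge 1)$; (5) flip a fair coin $B \in \{0,1\}$; (6) set $X \leftarrow X + Bm$, $m \leftarrow 2m$; (7) if $m \ge n$ and $X \le n$ then set $m \leftarrow n$ and let $Y$ be the $X$-th element of $A$ (in increasing order); (8) if $m \ge n$ and $X > n$ then set $X \leftarrow X - n$, $m \leftarrow m - n$; (9) return $Y$. Then the DDG corresponding to $\textsf{optimal\_discrete}(p)$ is an optimal DDG for $p$.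
   Context: Here $\mathbb{I}(\cdot)$ is the indicator function. Note that at the $d$-th iteration, $A$ is the set of $i$ whose $d$-th binary digit of the original $p_i$ (using the finite binary expansion when possible) is $1$. A discrete distribution generating tree (DDG) is a rooted binary tree (possibly infinite) whose leaves are labeled by outcomes; sampling proceeds from the root by flipping a fair coin at each internal node (0 = left child, 1 = right child) until a leaf is reached, whose label is output. An algorithm reading fair coin flips one at a time and eventually outputting a value corresponds to such a DDG. For a DDG $T$ let $N(T)$ be the random number of flips used. A DDG $T$ with output distribution $p$ is optimal for $p$ if for every DDG $T'$ with output distribution $p$ and every $i \ge 0$, $\mathbb{P}(N(T) > i) \le \mathbb{P}(N(T') > i)$.
   Formalization: The formal theorem assumes p_i < 1 for all i: if some p_k = 1, the update keeps p_k = 1 and the algorithm uses a geometric number of flips, whereas the one-leaf tree uses none, so the claim fails for every point mass. *)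

(* Defs.v *)
From HB Require Import structures.
From mathcomp Require Export all_boot all_order all_algebra.
From mathcomp Require Export finmap.
From mathcomp Require Export all_classical all_reals all_analysis.
Set Implicit Arguments.
Unset Strict Implicit.
Unset Printing Implicit Defensive.
Import Order.TTheory GRing.Theory Num.Theory.

Local Open Scope classical_set_scope.
Local Open Scope ring_scope.

(* Discrete distribution generating trees: rooted, possibly infinite, every
   internal node has exactly two children. *)
CoInductive ddg (L : Type) : Type :=
| Leaf of L
| Node of ddg L & ddg L.

Section Sampling.
Variable L : Type.
Implicit Types (T : ddg L) (b : nat -> bool).

Definition label T : option L := if T is Leaf x then Some x else None.

(* [false] is the flip 0 (left), [true] the flip 1 (right). *)
Definition child T (c : bool) : ddg L :=
  match T with
  | Leaf _ => T
  | Node l r => if c then r else l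
  end.

(* The position after (at most) n flips, stopping at the first leaf met. *)
Fixpoint descend T b n : ddg L :=
  if n is n'.+1 then child (descend T b n') (b n') else T.

(* The number of flips N(T), equal to +oo if no leaf is ever reached. *)
Definition flips_used (R : realType) T b : \bar R :=
  ereal_inf [set n%:R%:E | n in [set n : nat | isSome (label (descend T b n))]].

Definition outputs T b (x : L) : Prop :=
  exists n, label (descend T b n) = Some x.

End Sampling.

Record fair_coin_flips (R : realType) d (Omega : measurableType d)
    (P : probability Omega R) (B : nat -> {RV P >-> bool}) : Prop :=
  FairCoinFlips {
    flips_fair : forall n (c : bool),
      P (B n @^-1` [set c]) = (2^-1)%:E ;
    flips_independent : forall (J : {fset nat}) (C : nat -> set bool),
      P (\bigcap_(j in [set` J]) (B j @^-1` C j))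
      = (\prod_(j <- J) P (B j @^-1` C j))%E }.

(* Distributions on the positive integers: the value p 0 is irrelevant. *)
Definition distribution_on_posint (R : realType) (p : nat -> R) : Prop :=
  (forall i, (0 < i)%N -> 0 <= p i) /\
  (\sum_(1 <= i <oo) (p i)%:E = 1)%E.

Section Optimality.
Variables (R : realType) (d : measure_display) (Omega : measurableType d).
Variables (P : probability Omega R) (B : nat -> {RV P >-> bool}).
Implicit Types (T : ddg nat) (p : nat -> R).

(* As p sums to 1, this leaves mass 0 for the label 0 and for never reaching
   a leaf. *)
Definition has_output_distribution T p : Prop :=
  forall i, (0 < i)%N -> P [set w | outputs T (B ^~ w) i] = (p i)%:E.

Definition optimal_ddg T p : Prop :=
  has_output_distribution T p /\
  forall T', has_output_distribution T' p ->
  forall i : nat,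
    (P [set w | i%:R%:E < flips_used R T (B ^~ w)]
     <= P [set w | i%:R%:E < flips_used R T' (B ^~ w)])%E.

End Optimality.

(* The tree of the program that starts in state s and, as long as [out] gives
   no result, flips a coin and updates the state by [step]. *)
CoFixpoint ddg_of (S L : Type) (step : S -> bool -> S) (out : S -> option L)
    (s : S) : ddg L :=
  match out s with
  | Some x => Leaf x
  | None => Node (ddg_of step out (step s false)) (ddg_of step out (step s true))
  end.

Section Algorithm.
Variable R : realType.

Record state := State { st_p : nat -> R ; st_m : nat ; st_X : nat ; st_Y : nat }.

Definition initial_state (p : nat -> R) : state := State p 1 1 0.

(* This set is finite when p is summable; on an infinite set [fset_set] would
   return the empty set. *)
Definition digit_set (p : nat -> R) : {fset nat} :=
  fset_set [set i | (0 < i)%N /\ 1 <= 2 * p i].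

(* Counting from k = 1. *)
Definition kth_element (A : {fset nat}) (k : nat) : nat :=
  nth 0%N (sort leq A) k.-1.

Definition loop_body (s : state) (b : bool) : state :=
  let: State p m X Y := s in
  let A := digit_set p in
  let n := #|` A|%fset in
  let p := fun i => 2 * p i - (1 <= 2 * p i)%R%:R : R in
  let X := (X + b * m)%N in
  let m := (2 * m)%N in
  let: (m, Y) :=
    if (n <= m)%N && (X <= n)%N then (n, kth_element A X) else (m, Y) in
  let: (m, X) :=
    if (n <= m)%N && (n < X)%N then ((m - n)%N, (X - n)%N) else (m, X) in
  State p m X Y.

(* Outcomes are positive, so Y = 0 means that no outcome is decided yet. *)
Definition result (s : state) : option nat :=
  if st_Y s == 0%N then None else Some (st_Y s).

Definition optimal_discrete (p : nat -> R) : ddg nat :=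
  ddg_of loop_body result (initial_state p).

End Algorithm.

(* Main.v *)
(* Let f_d(i) = floor (2^d p_i). In any tree with output distribution p, the
   number of depth-d bit strings already decided on i is an integer at most
   2^d p_i, hence at most f_d(i), and no string is decided on 0; so at least
   2^d - sum_i f_d(i) strings are undecided. The algorithm attains these bounds
   with equality: by induction on d, for each x in 1..m exactly one undecided
   string of length d has X = x. One round sends the pairs (X, flip) bijectively
   to X + B m in 1..2m; the first n values go to the n elements of A, and the
   remaining 2m - n, shifted by n, are the new values of X. Here n <= 2m because
   m = 2^d - sum_i f_d(i) and sum_i f_(d+1)(i) <= 2^(d+1). *)
Require Import Defs.
From mathcomp Require Import zify ring lra.
Set Implicit Arguments.
Unset Strict Implicit.
Unset Printing Implicit Defensive.
Import Order.TTheory GRing.Theory Num.Theory.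
Import numFieldNormedType.Exports.
Local Open Scope ring_scope.

(** * Binary digits of the probabilities *)

Section Digits.
Local Open Scope classical_set_scope.
Variables (R : realType) (p : nat -> R).

(** For positive [i] this turns out to be the fractional part of 2^d p_i, and [int_part d i] its
    floor. The recursion copies the loop, so [frac_part d] is convertible with the program's array
    after [d] rounds. *)
Fixpoint frac_part (d : nat) : nat -> R :=
  if d is d'.+1 then
    fun i => 2 * frac_part d' i - (1 <= 2 * frac_part d' i)%R%:R
  else p.

Fixpoint int_part (d i : nat) : nat :=
  if d is d'.+1 then (2 * int_part d' i + (1 <= 2 * frac_part d' i)%R)%N
  else 0%N.

Definition digits (d : nat) : {fset nat} := digit_set (frac_part d).

(** The program's [m] after [d] rounds without output; [width_spec] shows that the truncated
    subtraction is exact. *)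
Fixpoint width (d : nat) : nat :=
  if d is d'.+1 then (2 * width d' - #|` digits d'|)%N else 1%N.

Lemma int_frac_part d i : 2 ^+ d * p i = (int_part d i)%:R + frac_part d i.
Proof.
elim: d => [|d IHd] /=; first by rewrite expr0 mul1r add0r.
by rewrite exprS -mulrA IHd natrD natrM; ring.
Qed.

Hypothesis p_lt1 : forall i, (0 < i)%N -> p i < 1.
Hypothesis p_distr : distribution_on_posint p.

Lemma p_ge0 i : (0 < i)%N -> 0 <= p i.
Proof. by case: p_distr => + _; apply. Qed.

(** Strictness rests on [p_lt1]: 1 is a fixed point of x -> 2x - 1, so a value 1 would persist
    forever. *)
Lemma frac_part_bounds d i : (0 < i)%N -> 0 <= frac_part d i < 1.
Proof.
move=> i_gt0; elim: d => [|d /andP[IH0 IH1]] /=; first by rewrite p_ge0 ?p_lt1.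
by case: (lerP 1 (2 * frac_part d i)) => h /=; apply/andP; split; lra.
Qed.

Lemma sum_p_le1 M : \sum_(1 <= i < M) p i <= 1.
Proof.
case: p_distr => p0 p1; rewrite -lee_fin -sumEFin -p1.
by apply: nneseries_lim_ge => i i1 _; rewrite lee_fin p0.
Qed.

Lemma p_small (e : R) : 0 < e ->
  exists M, forall i, (M <= i)%N -> (0 < i)%N -> p i < e.
Proof.
(* [p 0] is arbitrary, so it is replaced by 0 before forming a series over all naturals. *)
move=> e0; pose u i : R := if (0 < i)%N then p i else 0.
have u0 i : 0 <= u i by rewrite /u; case: ifP => // /p_ge0.
have cu : cvgn (series u).
  apply: nondecreasing_is_cvgn.
    by apply/nondecreasing_seqP => n; rewrite /series /= big_nat_recr //= lerDl.
  exists 1 => _ [n _ <-] /=; apply: le_trans (sum_p_le1 n.+1).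
  case: n => [|n]; first by rewrite /series /= !big_geq.
  rewrite /series /= big_ltn // [u 0%N]/u /= add0r [leRHS]big_nat_recr //=.
  rewrite ler_wpDr ?p_ge0 // le_eqVlt; apply/orP; left; apply/eqP.
  by apply: eq_big_nat => i /andP[i0 _]; rewrite /u i0.
have /cvgr0Pnorm_lt /(_ e e0) [M _ hM] := cvg_series_cvg_0 cu.
exists M => i Mi i0; have := hM i Mi; rewrite /u i0.
exact: le_lt_trans (ler_norm _).
Qed.

(** A digit 1 forces 2^(d+1) p_i >= 1, which fails for large [i] by [p_small]. Hence the digit set
    is finite and [fset_set] does not fall back to the empty set. *)
Lemma digit_bound d :
  exists M, forall i, (0 < i)%N -> 1 <= 2 * frac_part d i -> (i < M)%N.
Proof.
have [|M hM] := @p_small (2 ^- d.+1); first by rewrite invr_gt0 exprn_gt0.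
exists M => i i0 hi; rewrite ltnNge; apply/negP => Mi.
have := hM i Mi i0; rewrite ltNge => /negP; apply.
rewrite -(ler_pM2l (exprn_gt0 d.+1 (ltr0Sn R 1))) mulfV ?expf_neq0 ?pnatr_eq0 //.
rewrite exprS -mulrA int_frac_part; apply: le_trans hi _.
by rewrite ler_pM2l // lerDr.
Qed.

Lemma mem_digits d (i : nat) :
  (i \in digits d) = (0 < i)%N && (1 <= 2 * frac_part d i).
Proof.
rewrite /digits /digit_set in_fset_set; last first.
  have [M hM] := digit_bound d.
  by apply: (@sub_finite_set _ _ `I_M); [move=> j [/hM]; apply|exact: finite_II].
by apply/idP/andP; rewrite inE.
Qed.

Lemma digits_gt0 d (i : nat) : i \in digits d -> (0 < i)%N.
Proof. by rewrite mem_digits => /andP[]. Qed.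

Lemma card_digits d : exists M0, forall M, (M0 <= M)%N ->
  #|` digits d| = (\sum_(1 <= i < M) (1 <= 2 * frac_part d i)%R)%N.
Proof.
have [M0 hM0] := digit_bound d; exists M0 => M M0M.
transitivity (size [seq i <- index_iota 1 M | 1 <= 2 * frac_part d i]).
  apply: perm_size; apply: uniq_perm.
  - exact: fset_uniq.
  - by rewrite filter_uniq // iota_uniq.
  move=> i; rewrite mem_filter mem_index_iota mem_digits andbC.
  case: (boolP (1 <= 2 * frac_part d i)) => //= h.
  case: (ltnP 0 i) => //= i0; rewrite (leq_trans _ M0M) //; exact: hM0.
rewrite size_filter -sum1_count big_mkcond /=.
by apply: eq_bigr => i _; case: ifP.
Qed.

Lemma sum_int_part_le d M : (\sum_(1 <= i < M) int_part d i <= 2 ^ d)%N.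
Proof.
rewrite -(ler_nat R) natr_sum natrX.
apply: (@le_trans _ _ (2 ^+ d * \sum_(1 <= i < M) p i)); last first.
  by rewrite ler_piMr ?exprn_ge0 ?sum_p_le1.
rewrite mulr_sumr; apply: ler_sum_nat => i /andP[i0 _].
by rewrite int_frac_part lerDl; case/andP: (frac_part_bounds d i0).
Qed.

(** The identity at depth d, with [sum_int_part_le] at depth d+1, yields the bound on the number of
    digits; that bound makes the subtraction in [width d.+1] exact, which carries the identity to
    d+1. *)
Lemma width_spec d :
  (exists M0, forall M, (M0 <= M)%N ->
    (width d + \sum_(1 <= i < M) int_part d i = 2 ^ d)%N) /\
  (#|` digits d| <= 2 * width d)%N.
Proof.
have card_le k : (exists M0, forall M, (M0 <= M)%N ->
    (width k + \sum_(1 <= i < M) int_part k i = 2 ^ k)%N) ->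
    (#|` digits k| <= 2 * width k)%N.
  move=> [M0 hM0]; have [M1 hM1] := card_digits k.
  have := hM0 _ (leq_maxl M0 M1); rewrite (hM1 _ (leq_maxr M0 M1)).
  have := sum_int_part_le k.+1 (maxn M0 M1) => /=.
  by rewrite big_split /= -big_distrr /= expnS; lia.
suff h : exists M0, forall M, (M0 <= M)%N ->
    (width d + \sum_(1 <= i < M) int_part d i = 2 ^ d)%N.
  by split; [|exact: card_le].
elim: d => [|d IHd] /=; first by exists 0%N => M _; rewrite big1.
have le := card_le _ IHd.
case: IHd => M0 hM0; have [M1 hM1] := card_digits d.
exists (maxn M0 M1) => M; rewrite geq_max => /andP[/hM0 + /hM1].
move=> hd hc; rewrite big_split /= -big_distrr /= -hc expnS -hd mulnDr addnC.
by rewrite -addnA subnKC // addnC.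
Qed.

Lemma card_digits_le d : (#|` digits d| <= 2 * width d)%N.
Proof. by case: (width_spec d). Qed.

End Digits.

(** * Sums over bit strings *)

Section BitSums.
Local Open Scope nat_scope.

Lemma big_bits0 (F : seq bool -> nat) :
  \sum_(t : 0.-tuple bool) F t = F [::].
Proof.
rewrite (big_pred1 [tuple]) // => t; rewrite (tuple0 t).
by symmetry; apply/eqP; apply: val_inj.
Qed.

Lemma big_bits_rcons d (F : seq bool -> nat) :
  \sum_(t : d.+1.-tuple bool) F t =
  \sum_(t : d.-tuple bool) (F (rcons t false) + F (rcons t true)).
Proof.
pose f (u : d.-tuple bool * bool) := [tuple of rcons u.1 u.2].
have f_inj : injective f.
  move=> [t c] [t' c'] /(congr1 val) /= /rcons_inj [/val_inj -> ->] //.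
have f_bij : bijective f.
  apply: inj_card_bij f_inj _.
  by rewrite card_prod !card_tuple card_bool expnS mulnC.
rewrite (reindex f) /=; last exact: onW_bij.
rewrite -(pair_bigA _ (fun (t : d.-tuple bool) c => F (rcons t c))) /=.
by apply: eq_bigr => t _; rewrite big_bool addnC.
Qed.

Lemma sum_bits1 d : \sum_(t : d.-tuple bool) 1 = 2 ^ d.
Proof. by rewrite sum1_card card_tuple card_bool. Qed.

End BitSums.

(** * Trees and the run of the algorithm *)

Section Trees.
Variable L : Type.
Implicit Types (T : ddg L) (b : nat -> bool) (s : seq bool).

Definition position T s : ddg L := foldl (@child L) T s.

Lemma position_rcons T s c : position T (rcons s c) = child (position T s) c.
Proof. by rewrite /position -cats1 foldl_cat. Qed.

Lemma descend_position T b n : descend T b n = position T (mkseq b n).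
Proof.
elim: n => [//|n IHn].
by rewrite /mkseq -[n.+1 in RHS]addn1 iotaD map_cat cats1 position_rcons -IHn.
Qed.

Lemma child_leaf T c : isSome (label T) -> child T c = T.
Proof. by case: T. Qed.

Lemma descend_leaf T b m n : (m <= n)%N -> isSome (label (descend T b m)) ->
  descend T b n = descend T b m.
Proof.
move=> mn; rewrite -(subnKC mn).
elim: (n - m)%N => [|k IHk]; first by rewrite addn0.
by move=> h; rewrite addnS /= IHk // child_leaf.
Qed.

Lemma outputs_uniq T b x y : outputs T b x -> outputs T b y -> x = y.
Proof.
move=> [m hm] [n hn]; wlog mn : m n x y hm hn / (m <= n)%N.
  by move=> h; case/orP: (leq_total m n) => le; [|symmetry]; apply: (h _ _ _ _ _ _ le).
by move: hn; rewrite (descend_leaf mn) hm // => -[].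
Qed.

Lemma lt_flips_used (R : realType) T b n :
  (n%:R%:E < flips_used R T b)%E = ~~ isSome (label (descend T b n)).
Proof.
apply/idP/idP => [|h].
  apply: contraL => h; rewrite -leNgt; apply: ereal_inf_lbound.
  by exists n.
(* Strict bounds on the members do not pass to an infimum, but the bound n+1 does, also for an empty
   set. *)
apply: (@lt_le_trans _ _ (n.+1%:R%:E)); first by rewrite lte_fin ltr_nat.
apply: le_ereal_inf_tmp => _ [k /= hk <-]; rewrite lee_fin ler_nat ltnNge.
apply: contraNN h => kn; by rewrite (descend_leaf kn).
Qed.

Lemma ddg_of_unfold (S : Type) (step : S -> bool -> S) (out : S -> option L) x :
  ddg_of step out x =
  match out x with
  | Some y => Leaf y
  | None => Node (ddg_of step out (step x false)) (ddg_of step out (step x true))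
  end.
Proof.
(* A cofixpoint reduces only under a [match]; this identity supplies one. *)
have frob T : T = match T with Leaf y => Leaf y | Node l r => Node l r end.
  by case: T.
by rewrite [LHS]frob /=; case: (out x).
Qed.

Lemma label_ddg_of (S : Type) (step : S -> bool -> S) (out : S -> option L) x :
  label (ddg_of step out x) = out x.
Proof. by rewrite ddg_of_unfold; case: (out x). Qed.

(** Freezing the state once a result exists mirrors [child] on a leaf, so runs make sense on bit
    strings of any length. *)
Definition step_if (S : Type) (step : S -> bool -> S) (out : S -> option L)
    x c :=
  if out x is Some _ then x else step x c.

Lemma position_ddg_of (S : Type) (step : S -> bool -> S) (out : S -> option L)
    x s :
  position (ddg_of step out x) s = ddg_of step out (foldl (step_if step out) x s).
Proof.
elim: s x => //= c s IHs x; rewrite -IHs /position /=; congr foldl.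
by rewrite (ddg_of_unfold step out x) /step_if; case E: (out x) => [y|] /=;
  [rewrite ddg_of_unfold E|case: c].
Qed.

End Trees.

(** * The program's state along a bit string, and counts of decided and undecided strings *)

Section Run.
Variables (R : realType) (p : nat -> R).
Hypothesis p_lt1 : forall i, (0 < i)%N -> p i < 1.
Hypothesis p_distr : distribution_on_posint p.
Local Open Scope nat_scope.

Definition run (s : seq bool) : state R :=
  foldl (step_if (@loop_body R) (@result R)) (initial_state p) s.

Lemma label_run s : label (position (optimal_discrete p) s) = result (run s).
Proof. by rewrite /optimal_discrete position_ddg_of label_ddg_of. Qed.

Lemma run_rcons s c : run (rcons s c) =
  if st_Y (run s) == 0 then loop_body (run s) c else run s.
Proof.
rewrite /run -cats1 foldl_cat /= {1}/step_if /result -/(run s).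
by case: ifP.
Qed.

Definition undecided_at (X : nat) (s : seq bool) : bool :=
  (st_Y (run s) == 0) && (st_X (run s) == X).

Lemma kth_element_gt0 d k : 0 < k <= #|` digits p d| ->
  0 < kth_element (digits p d) k.
Proof.
move=> /andP[k0 kn]; apply: (digits_gt0 p_distr (d := d)).
rewrite -(mem_sort leq) /kth_element mem_nth // size_sort prednK //.
Qed.

(** Since n <= 2w, the guard on [m] always holds, so comparing [X'] with [n] alone decides between
    output and shift. *)
Lemma loop_bodyE d X (c : bool) (n := #|` digits p d|) (w := width p d)
    (X' := X + c * w) : 0 < X <= w ->
  loop_body (State (frac_part p d) w X 0) c =
  if X' <= n then State (frac_part p d.+1) n X' (kth_element (digits p d) X')
  else State (frac_part p d.+1) (width p d.+1) (X' - n) 0.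
Proof.
move=> /andP[X0 Xw]; have le : n <= 2 * w by exact: card_digits_le.
rewrite /loop_body -/(digits p d) -/n -/X' le /=.
by case: (leqP X' n) => h; rewrite ?leqnn ?le ?(ltnNge n X') ?h //= ltnNge h.
Qed.

(** Undecided strings of equal length thus differ only in [X]. *)
Lemma run_undecided d s : size s = d -> st_Y (run s) == 0 ->
  exists2 X, 0 < X <= width p d & run s = State (frac_part p d) (width p d) X 0.
Proof.
elim/last_ind: s d => [|s c IHs] d; first by move=> <- _; exists 1.
rewrite size_rcons run_rcons => <-; case: ifP => [Y0|->] //.
have [X hX E] := IHs _ erefl Y0; rewrite E loop_bodyE //.
case: leqP => h /=; last first.
  by move=> _; eexists; last reflexivity; case/andP: hX => ? ?; case: c h => /=; lia.
rewrite eqn0Ngt kth_element_gt0 // h andbT; lia.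
Qed.

(* A flip with [x + n <= c * w] cannot lead to the value [x]: the truncated
   subtraction then gives position 0, which is never occupied. *)
Lemma undecided_at_rcons d x s (c : bool) : size s = d ->
  undecided_at x (rcons s c) =
  (0 < x) && undecided_at (x + #|` digits p d| - c * width p d) s.
Proof.
move=> sz; rewrite /undecided_at run_rcons.
case: ifP => [Y0|->]; last by rewrite andbF.
have [X hX E] := run_undecided sz Y0; rewrite E loop_bodyE //.
have le := card_digits_le p_lt1 p_distr d.
case: (leqP (X + c * width p d)) => h /=; last by case: c h => /=; lia.
rewrite eqn0Ngt kth_element_gt0 /=; last by rewrite h andbT; lia.
by case: c h => /=; lia.
Qed.

(** With n digits and m = [width p d], a new value x > 0 has the predecessor x + n by flip 0 if x +
    n <= m, and x + n - m by flip 1 if m < x + n <= 2m: exactly one for x in 1..2m - n. *)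
Lemma sum_undecided_at d x :
  \sum_(t : d.-tuple bool) undecided_at x t = (0 < x <= width p d).
Proof.
elim: d x => [|d IHd] x.
  by rewrite (big_bits0 (undecided_at x)) /undecided_at /=; lia.
rewrite (big_bits_rcons d (undecided_at x)).
under eq_bigr => t _ do rewrite !(undecided_at_rcons x _ (size_tuple t)).
case: x => [|x]; first by rewrite big1.
rewrite big_split /= !IHd /=.
by have := card_digits_le p_lt1 p_distr d; lia.
Qed.

Lemma kth_element_eq d k (i : nat) : 0 < k <= #|` digits p d| ->
  (kth_element (digits p d) k == i) =
  (i \in digits p d) && (k == (index i (sort leq (digits p d))).+1).
Proof.
case: k => // k /andP[_ kn]; rewrite /kth_element eqSS /=.
have u : uniq (sort leq (digits p d)) by rewrite sort_uniq fset_uniq.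
have sz : k < size (sort leq (digits p d)) by rewrite size_sort.
apply/eqP/andP => [<-|[hi /eqP ->]]; last by rewrite nth_index // mem_sort.
by rewrite index_uniq // -(mem_sort leq) mem_nth.
Qed.

(** A decided string stays decided; a newly decided one had X + c m equal to the rank of [i],
    counted from 1. If the rank is at most c m, truncation gives the unoccupied position 0. *)
Lemma decided_rcons d (i : nat) s (c : bool) : size s = d -> 0 < i ->
  (st_Y (run (rcons s c)) == i) = (st_Y (run s) == i) +
    ((i \in digits p d) && undecided_at
      ((index i (sort leq (digits p d))).+1 - c * width p d) s) :> nat.
Proof.
move=> sz i0; rewrite run_rcons /undecided_at.
case: ifP => [Y0|_]; last by rewrite andbF addn0.
have [X hX E] := run_undecided sz Y0; rewrite E loop_bodyE //= [0 == i]eq_sym.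
have le := card_digits_le p_lt1 p_distr d.
have -> : (i == 0) = false by lia.
rewrite add0n; case: (leqP (X + c * width p d)) => h /=.
  rewrite kth_element_eq; last by rewrite h andbT; lia.
  by congr (nat_of_bool (_ && _)); case: c h => /=; lia.
have -> : (0 == i) = false by lia.
case: (boolP (i \in digits p d)) => //=; rewrite -(mem_sort leq) -index_mem size_sort.
by case: c h => /=; lia.
Qed.

(** Each rank is at most 2m, so exactly one pair of position and flip hits it. Old strings double
    and each element of the digit set gains one, which is the recursion of [int_part]. *)
Lemma sum_decided d i : 0 < i ->
  \sum_(t : d.-tuple bool) (st_Y (run t) == i) = int_part p d i.
Proof.
move=> i0; elim: d => [|d IHd] /=.
  by rewrite (big_bits0 (fun s => st_Y (run s) == i)) /=; lia.
rewrite (big_bits_rcons d (fun s => st_Y (run s) == i)).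
under eq_bigr => t _ do rewrite !(decided_rcons _ (size_tuple t) i0).
rewrite !big_split /= IHd.
have -> : (1 <= 2 * frac_part p d i)%R = (i \in digits p d).
  by rewrite mem_digits // i0.
have le := card_digits_le p_lt1 p_distr d.
case: (boolP (i \in digits p d)) => /= hi; last by rewrite !big1 //; lia.
rewrite !sum_undecided_at; move: hi.
rewrite -(mem_sort leq) -index_mem size_sort; move: le.
by move: #|` _| (index _ _) (width p d) => n k w; lia.
Qed.

End Run.

(** * Probabilities of the events at depth n *)

Section CoinFlips.
Local Open Scope classical_set_scope.
Variables (R : realType) (d : measure_display) (Omega : measurableType d).
Variables (P : probability Omega R) (B : nat -> {RV P >-> bool}).
Hypothesis hB : fair_coin_flips B.

Lemma cylinderE n (t : n.-tuple bool) :
  [set w | mkseq (B ^~ w) n = t] =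
  \bigcap_(j in [set` [fset j in iota 0 n]%fset]) (B j @^-1` [set nth false t j]).
Proof.
apply/seteqP; split => w /=.
  move=> e j; rewrite /= !inE mem_iota /= => jn.
  by rewrite -e nth_mkseq.
move=> h; apply: (@eq_from_nth _ false); rewrite size_mkseq ?size_tuple // => j jn.
by rewrite nth_mkseq // h //= !inE mem_iota.
Qed.

Lemma measurable_cylinder n (t : n.-tuple bool) :
  measurable [set w | mkseq (B ^~ w) n = t].
Proof.
rewrite cylinderE; apply: fin_bigcap_measurable; first exact: finite_fset.
by move=> j _; apply: measurable_funPTI.
Qed.

Lemma prob_cylinder n (t : n.-tuple bool) :
  P [set w | mkseq (B ^~ w) n = t] = (2 ^- n)%:E.
Proof.
rewrite cylinderE (flips_independent hB).
under eq_bigr => j _ do rewrite (flips_fair hB).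
rewrite prodEFin big_const_seq count_predT iter_mulr_1 -exprVn; congr (_ ^+ _)%:E.
rewrite -[RHS](size_iota 0 n); apply: perm_size; apply: uniq_perm.
- exact: fset_uniq.
- exact: iota_uniq.
- by move=> j; rewrite !inE.
Qed.

Lemma bits_event_bigcup n (Q : pred (seq bool)) :
  [set w | Q (mkseq (B ^~ w) n)] =
  \bigcup_(t in [set` [pred t : n.-tuple bool | Q t]])
    [set w | mkseq (B ^~ w) n = t].
Proof.
apply/seteqP; split => w /=; last by move=> [t Qt ->].
move=> h; have sz : size (mkseq (B ^~ w) n) == n by rewrite size_mkseq.
by exists (Tuple sz).
Qed.

Lemma measurable_bits n (Q : pred (seq bool)) :
  measurable [set w | Q (mkseq (B ^~ w) n)].
Proof.
rewrite bits_event_bigcup; apply: fin_bigcup_measurable; first exact: finite_finset.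
by move=> t _; exact: measurable_cylinder.
Qed.

(** Reduces every event at a fixed depth to counting bit strings. *)
Lemma prob_bits n (Q : pred (seq bool)) :
  P [set w | Q (mkseq (B ^~ w) n)] =
  ((\sum_(t : n.-tuple bool) Q t)%N%:R / 2 ^+ n)%:E.
Proof.
rewrite bits_event_bigcup measure_fin_bigcup.
- rewrite (eq_fsbigr (fun=> (2 ^- n)%:E)); last by move=> t _; exact: prob_cylinder.
  rewrite -(@bigfs _ _ _ _ (index_enum _)); first last.
  - by move=> t _; rewrite mem_index_enum.
  - exact: index_enum_uniq.
  rewrite sumEFin natr_sum mulr_suml big_mkcond /=.
  by congr EFin; apply: eq_bigr => t _; case: (Q t); rewrite ?mul1r ?mul0r.
- exact: finite_finset.
- by move=> t u _ _ [w [/= -> /val_inj]].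
- by move=> t _; exact: measurable_cylinder.
Qed.

(** * Decided and undecided strings of an arbitrary tree *)

Section Tree.
Variable T : ddg nat.

(** Strings are counted, not leaves: a leaf at depth k <= n contributes 2^(n-k). *)
Definition leaf_count n i : nat :=
  (\sum_(t : n.-tuple bool) (label (position T t) == Some i))%N.
Definition live_count n : nat :=
  (\sum_(t : n.-tuple bool) (label (position T t) == None))%N.

Lemma live_leaf_count n : exists M0, forall M, (M0 <= M)%N ->
  (live_count n + \sum_(0 <= i < M) leaf_count n i = 2 ^ n)%N.
Proof.
pose lbl (t : n.-tuple bool) := label (position T t).
(* This bound exceeds every label seen at depth [n]; undecided strings count as label 0. *)
exists (\max_t (odflt 0 (lbl t)).+1)%N => M hM.
rewrite /leaf_count exchange_big /= -big_split /= -sum_bits1.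
apply: eq_bigr => t _.
have := leq_trans (leq_bigmax t) hM; rewrite /= /lbl.
case: (label _) => [x|] /= hx; last by rewrite big1.
rewrite big_mkord (bigD1 (Ordinal hx)) //= eqxx big1 ?addn0 // => i /eqP ne.
by case: eqP => // -[e]; case: ne; apply: val_inj.
Qed.

Lemma prob_live n :
  P [set w | (n%:R%:E < flips_used R T (B ^~ w))%E] =
  ((live_count n)%:R / 2 ^+ n)%:E.
Proof.
rewrite -(prob_bits n (fun s => label (position T s) == None)).
by congr (P _); apply/seteqP; split => w /=;
  rewrite lt_flips_used descend_position; case: (label _).
Qed.

Lemma outputs_bigcup i : [set w | outputs T (B ^~ w) i] =
  \bigcup_n [set w | label (position T (mkseq (B ^~ w) n)) == Some i].
Proof.
apply/seteqP; split => w /= [n].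
  by rewrite descend_position => h; exists n => //=; apply/eqP.
by move=> _ /= /eqP h; exists n; rewrite descend_position.
Qed.

Lemma measurable_leaf n i :
  measurable [set w | label (position T (mkseq (B ^~ w) n)) == Some i].
Proof. exact: (measurable_bits n (fun s => label (position T s) == Some i)). Qed.

Lemma measurable_outputs i : measurable [set w | outputs T (B ^~ w) i].
Proof.
by rewrite outputs_bigcup; apply: bigcup_measurable => n _; exact: measurable_leaf.
Qed.

Lemma prob_leaf n i :
  P [set w | label (position T (mkseq (B ^~ w) n)) == Some i] =
  ((leaf_count n i)%:R / 2 ^+ n)%:E.
Proof. exact: (prob_bits n (fun s => label (position T s) == Some i)). Qed.

Lemma leaf_count_le n i :
  (((leaf_count n i)%:R / 2 ^+ n)%:E <= P [set w | outputs T (B ^~ w) i])%E.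
Proof.
rewrite -prob_leaf; apply: le_measure; rewrite ?inE.
- exact: measurable_leaf.
- exact: measurable_outputs.
- by rewrite outputs_bigcup => w h; exists n.
Qed.

(** Leaves are absorbing, so the events increase with [n] and continuity from below applies. *)
Lemma leaf_count_cvg i :
  ((leaf_count n i)%:R / 2 ^+ n)%:E @[n --> \oo]
    --> P [set w | outputs T (B ^~ w) i].
Proof.
rewrite outputs_bigcup; under eq_fun do rewrite -prob_leaf.
apply: nondecreasing_cvg_mu; first by move=> n; exact: measurable_leaf.
  by rewrite -outputs_bigcup; exact: measurable_outputs.
move=> m n mn; apply/subsetPset => w /=.
by rewrite -!descend_position => /eqP h; rewrite (descend_leaf mn) h.
Qed.

End Tree.

(** For i > 0 the count is an integer at most 2^n p_i, which is below [int_part p n i] + 1. *)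
Lemma leaf_count_bound T (p : nat -> R) n (i : nat) : distribution_on_posint p ->
  (forall i, (0 < i)%N -> p i < 1) -> has_output_distribution B T p ->
  (leaf_count T n i <= if i == 0 then 0 else int_part p n i)%N.
Proof.
move=> hp hp1 hT; have n0 : (0 : R) < 2 ^+ n by rewrite exprn_gt0.
case: (posnP i) => [->|i0] /=.
  (* The output events are disjoint, and those of positive labels already have total mass 1, leaving
     none for label 0. *)
  have : (P [set w | outputs T (B ^~ w) 0%N] + 1 <= 1)%E.
    have e1 : (\sum_(1 <= i <oo) P [set w | outputs T (B ^~ w) i] = 1)%E.
      rewrite -hp.2; congr (limn _); apply/funext => k.
      by apply: eq_big_nat => j /andP[j0 _]; exact: hT.
    rewrite -[X in (_ + X <= _)%E]e1 -(@nneseries_recl _ xpredT) //.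
    rewrite (eq_eseriesl (Q := [pred i | i \in setT])); last first.
      by move=> j; rewrite /= mem_set.
    rewrite -measure_bigcup.
    - apply: probability_le1; apply: bigcup_measurable => j _.
      exact: measurable_outputs.
    - by move=> j _; exact: measurable_outputs.
    - by move=> j k _ _ [w [/= hj hk]]; exact: outputs_uniq hj hk.
  move=> h; have := leaf_count_le T n 0%N.
  have : (P [set w | outputs T (B ^~ w) 0%N] <= 0)%E.
    by rewrite -(@leeD2rE _ 1%E) ?add0e.
  move=> h0 h1; have := le_trans h1 h0.
  by rewrite lee_fin pmulr_lle0 ?invr_gt0 // lern0 leqn0.
rewrite -ltnS -(ltr_nat R).
have := leaf_count_le T n i; rewrite hT // lee_fin ler_pdivrMr // mulrC.
rewrite int_frac_part => h; apply: le_lt_trans h _.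
by rewrite -natr1 ltrD2l; case/andP: (frac_part_bounds hp1 hp n i0).
Qed.

(** * The program's tree attains the bounds *)

Section Optimal.
Variable p : nat -> R.
Hypothesis p_distr : distribution_on_posint p.
Hypothesis p_lt1 : forall i, (0 < i)%N -> p i < 1.

Lemma leaf_count_optimal n i :
  leaf_count (optimal_discrete p) n i = if i == 0%N then 0%N else int_part p n i.
Proof.
case: (posnP i) => [->|i0].
  by apply: big1 => t _; rewrite label_run /result; case: (st_Y _).
rewrite -(sum_decided p_lt1 p_distr) //; apply: eq_bigr => t _.
by rewrite label_run /result; case: (st_Y _) => [|y] //=; case: i i0.
Qed.

(** The floor errs by less than 1, so the quotient lies between p_i - 2^-n and p_i. *)
Lemma int_part_cvg i : (0 < i)%N ->
  (int_part p n i)%:R / 2 ^+ n @[n --> \oo] --> p i.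
Proof.
move=> i0; have g0 : p i - geometric 1 2^-1 n @[n --> \oo] --> p i.
  rewrite -[X in _ --> X]subr0; apply: cvgB; first exact: cvg_cst.
  by apply: cvg_geometric; rewrite gtr0_norm ?invr_gt0 // invf_lt1 ?ltr1n.
apply: squeeze_cvgr g0 (cvg_cst (p i)); apply: nearW => n.
have n0 : (0 : R) < 2 ^+ n by rewrite exprn_gt0.
rewrite /geometric /= mul1r exprVn ler_pdivrMr // ler_pdivlMr // mulrBl mulVf ?gt_eqF //.
rewrite mulrC int_frac_part.
by case/andP: (frac_part_bounds p_lt1 p_distr n i0) => h0 h1; apply/andP; split; lra.
Qed.

(** The same sequence tends to the output probability and to p_i, so the two limits agree. *)
Lemma optimal_output : has_output_distribution B (optimal_discrete p) p.
Proof.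
move=> i i0; have := @leaf_count_cvg (optimal_discrete p) i.
under eq_fun do rewrite leaf_count_optimal eqn0Ngt i0 /=.
move=> h; apply: (cvg_unique _ h); first exact: ereal_hausdorff.
by apply: cvg_EFin; [exact: nearW|exact: int_part_cvg].
Qed.

(** Both trees share 2^n strings among live ones and labels; the program's count is maximal for
    every label, so its live count is minimal. *)
Lemma live_count_optimal T n : has_output_distribution B T p ->
  (live_count (optimal_discrete p) n <= live_count T n)%N.
Proof.
move=> hT.
have [M0 h0] := live_leaf_count (optimal_discrete p) n.
have [M1 h1] := live_leaf_count T n.
have := h0 _ (leq_maxl M0 M1); rewrite -(h1 _ (leq_maxr M0 M1)) => e.
rewrite -(leq_add2r
  (\sum_(0 <= i < maxn M0 M1) leaf_count (optimal_discrete p) n i)).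
rewrite e leq_add2l; apply: leq_sum => i _.
by rewrite leaf_count_optimal; apply: leaf_count_bound.
Qed.

End Optimal.
End CoinFlips.

Theorem theorem5 (R : realType) (d : measure_display)
    (Omega : measurableType d) (P : probability Omega R)
    (B : nat -> {RV P >-> bool}) (hB : fair_coin_flips B)
    (p : nat -> R) (hp : distribution_on_posint p)
    (hp1 : forall i : nat, (0 < i)%N -> p i < 1) :
  optimal_ddg B (optimal_discrete p) p.
Proof.
split=> [|T hT n]; first exact: optimal_output.
rewrite !prob_live // lee_fin ler_pM2r ?invr_gt0 ?exprn_gt0 // ler_nat.
exact: (live_count_optimal hB hp hp1).
Qed.
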